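(* Let $X\in\mathbb{R}^{n\times p}$ ($n\le p$) have i.i.d. $N(0,1)$ entries, and let $\widehat\theta\in\mathbb{R}^p$ be a (possibly random) vector belonging to the row space of $X$. Let $\eta=\widehat\theta+z$, where $z\in\mathbb{R}^p$ is independent of $(X,\widehat\theta)$ and its entries are independent with $z_j\sim(1-\epsilon)\delta_0+\epsilon Q_j$, $j=1,\dots,p$, where $\epsilon\in[0,1)$ and $Q_1,\dots,Q_p$ are arbitrary probability distributions on $\mathbb{R}$. Let $\widetilde u\in\operatorname{argmin}_{u\in\mathbb{R}^n}\|\eta-X^Tu\|_1$ and $\widetilde\theta=X^T\widetilde u$. Assume $$\frac{\sqrt{\frac np}\,\log\left(\frac{ep}{n}\right)}{1-\epsilon}$$ is sufficiently small. Then $\widetilde\theta=\widehat\theta$ with high probability.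
   Context: $\|\cdot\|_1$ is the $\ell_1$ norm and $\delta_0$ the point mass at $0$. Examples of $\widehat\theta$ in the row space of $X$: the minimum norm solution $X^T(XX^T)^{-1}y$ for any response vector $y\in\mathbb{R}^n$, or a gradient-based algorithm initialized at $0$ for an objective $\frac1n\sum_i\mathcal{L}(y_i,x_i^T\theta)$, where $x_i^T$ is the $i$-th row of $X$. Convention: ''sufficiently small'' and ''with high probability'' mean that for every $\delta\in(0,1)$ there is $c>0$ depending only on $\delta$ such that if the displayed quantity is at most $c$ then the conclusion holds with probability at least $1-\delta$. *)

(* Defs.v *)
From HB Require Import structures.
From mathcomp Require Import all_boot all_order all_algebra.
From mathcomp Require Import all_classical all_reals all_analysis.

Set Implicit Arguments.
Unset Strict Implicit.
Unset Printing Implicit Defensive.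

Import Order.TTheory GRing.Theory Num.Theory.
Import numFieldNormedType.Exports.

Local Open Scope classical_set_scope.
Local Open Scope ring_scope.

(* mathcomp-analysis puts no measurable structure on matrices: random matrices
   and random vectors are families of real random variables, assembled
   pointwise by the next two definitions. *)

Definition random_mx d (T : measurableType d) (R : realType)
    (P : probability T R) n p (X : 'I_n -> 'I_p -> {RV P >-> R}) (w : T) :
  'M[R]_(n, p) := \matrix_(i < n, j < p) X i j w.

Definition random_col d (T : measurableType d) (R : realType)
    (P : probability T R) p (v : 'I_p -> {RV P >-> R}) (w : T) :
  'cV[R]_p := \col_(j < p) v j w.

Definition mutually_independent d (T : measurableType d) (R : realType)
    (P : probability T R) (I : finType) (Y : I -> {RV P >-> R}) : Prop :=
  forall (J : {set I}) (B : I -> set R),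
    (forall i, i \in J -> measurable (B i)) ->
    (P (\bigcap_(i in [set` J]) Y i @^-1` B i) =
     \big[mule/1%E]_(i in J) P (Y i @^-1` B i))%E.

Definition var_events d (T : measurableType d) (R : realType)
    (P : probability T R) (I : Type) (Y : I -> {RV P >-> R}) : set (set T) :=
  \bigcup_i preimage_set_system setT (Y i) measurable.

Definition independent_classes d (T : measurableType d) (R : realType)
    (P : probability T R) (F G : set (set T)) : Prop :=
  forall A B, F A -> G B -> (P (A `&` B) = P A * P B)%E.

Definition l1norm (R : realType) p (v : 'cV[R]_p) : R :=
  \sum_(j < p) `|v j 0|.

Definition argmin (U : Type) (R : realType) (f : U -> R) : set U :=
  [set u | forall u', f u <= f u'].

(* For a measurable event A this is just q <= P A. The inner approximation
   gives a meaning to the bound without any measurability of A. *)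
Definition with_prob_ge d (T : measurableType d) (R : realType)
    (P : probability T R) (q : R) (A : set T) : Prop :=
  exists E : set T, [/\ measurable E, E `<=` A & (q%:E <= P E)%E].

(* Main.v *)
(* Write theta = X^T u0, so that eta - X^T u = z - X^T v with v = u - u0. Since
   |z - t| >= |z| + gain z t, where gain z t is |t| if z = 0 and - sgn(z) t
   otherwise, it suffices that with high probability, simultaneously for all
   unit vectors v, G(v) = sum_j gain z_j <x_j, v> > 0.
   Put q = 1 - epsilon. For a fixed unit v the factors of exp(- l G(v)) are
   independent; a factor has mean at most 1 - c1 q l + c2 l^2, because z_j = 0
   has probability at least q and E |<x_j, v>| > 0, while the linear part has
   mean 0. With l of order q this gives G(v) >= q p / 64 outside an event of
   probability exp(- c3 p q^2).
   A net of mesh 1 / K with K of order 1 / q has at most (C / q)^n points, and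
   passing from v to the net costs at most sup_e sum_j |<x_j, e>| over the
   rounding errors e, which is of order p / K by a union bound over signs. The
   assumption on n, p and q makes p q^2 larger than n log (C / q): this is
   where the logarithm is needed.
   All union bounds are made at once, by applying Markov's inequality to a
   single finite sum of exponentials. *)

Require Import Defs.
From HB Require Import structures.
From mathcomp Require Import all_boot all_order all_algebra.
From mathcomp Require Import all_classical all_reals all_analysis.
From mathcomp Require Import measurable_realfun.
From mathcomp Require Import ring lra.

Set Implicit Arguments.
Unset Strict Implicit.
Unset Printing Implicit Defensive.

Import Order.TTheory GRing.Theory Num.Theory.
Import numFieldNormedType.Exports.

Local Open Scope classical_set_scope.
Local Open Scope ring_scope.

(** * Integrals against a weighted law *)

Section weighted_law.
Context d d' (T : measurableType d) (T' : measurableType d') (R : realType).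
Variables (mu : {measure set T -> \bar R}) (nu : {measure set T' -> \bar R}).
Variables (Y : T -> T') (g : T -> R) (c : R).
Hypotheses (mY : measurable_fun setT Y) (mg : measurable_fun setT g).
Hypothesis g0 : forall x, 0 <= g x.
Hypothesis lawY : forall A, measurable A ->
  (\int[mu]_x (\1_A (Y x) * g x)%:E = c%:E * nu A)%E.

Import HBNNSimple.

Let weighted_law_nnsfun (h : {nnsfun T' >-> R}) :
  (\int[mu]_x (h (Y x) * g x)%:E = c%:E * \int[nu]_y (h y)%:E)%E.
Proof.
have mh y : measurable (h @^-1` [set y]) by [].
transitivity (\int[mu]_x (\sum_(y \in range h)
    (y * (\1_(h @^-1` [set y]) (Y x) * g x))%:E))%E.
  apply: eq_integral => x _; rewrite EFinM fimfunE -fsumEFin//.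
  rewrite ge0_mule_fsuml => [|y]; last exact: nnfun_muleindic_ge0.
  by apply: eq_fsbigr => y _; rewrite -EFinM mulrA.
have m1 y : measurable_fun setT (fun x => \1_(h @^-1` [set y]) (Y x) * g x : R).
  by apply: measurable_funM => //; apply: measurableT_comp => //.
rewrite ge0_integral_fsum//; last 2 first.
- move=> y; apply/measurable_EFinP; exact: measurable_funM.
- move=> y x _; rewrite mulrA EFinM mule_ge0 ?lee_fin//.
  exact: nnfun_muleindic_ge0.
rewrite -[RHS]/(c%:E * \int[nu]_y (EFin \o h) y)%E integralT_nnsfun sintegralE.
rewrite ge0_mule_fsumr; last by move=> y; exact: nnsfun_mulemu_ge0.
apply: eq_fsbigr => y /[!inE] -[y' _ hy].
under eq_integral do rewrite EFinM.
rewrite ge0_integralZl_EFin//.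
- by rewrite lawY// muleCA.
- by move=> x _; rewrite lee_fin mulr_ge0.
- exact/measurable_EFinP.
- by rewrite -hy.
Qed.

(** Simple functions are handled by linearity over level sets, the rest by monotone convergence.
    This serves both to split off one independent factor and to integrate against the Gaussian
    density. *)
Lemma weighted_law (f : T' -> R) : measurable_fun setT f ->
  (forall y, 0 <= f y) ->
  (\int[mu]_x (f (Y x) * g x)%:E = c%:E * \int[nu]_y (f y)%:E)%E.
Proof.
move=> mf f0.
have mf' : measurable_fun setT (EFin \o f) by exact/measurable_EFinP.
pose h := nnsfun_approx measurableT mf'.
have hf y : (h n y)%:E @[n --> \oo] --> (f y)%:E.
  by apply: (cvg_nnsfun_approx measurableT mf') => // x _; rewrite lee_fin.
transitivity (limn (fun n => \int[mu]_x (h n (Y x) * g x)%:E))%E.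
  rewrite -monotone_convergence//; last 3 first.
  - move=> n; apply/measurable_EFinP; apply: measurable_funM => //.
    by apply: measurableT_comp.
  - by move=> n x _; rewrite lee_fin mulr_ge0.
  - move=> x _ a b ab; rewrite lee_fin ler_wpM2r//.
    exact/lefP/nd_nnsfun_approx.
  apply: eq_integral => x _; apply/esym/cvg_lim => //.
  under eq_fun do rewrite EFinM muleC.
  rewrite EFinM muleC.
  by apply: cvgeZl => //; exact: hf.
transitivity (limn (fun n => c%:E * \int[nu]_y (h n y)%:E))%E.
  by under eq_fun do rewrite weighted_law_nnsfun.
have ndh : nondecreasing_seq (fun n => \int[nu]_y (h n y)%:E)%E.
  move=> a b ab; apply: ge0_le_integral => //.
  - by move=> y _; rewrite lee_fin.
  - exact/measurable_EFinP.
  - exact/measurable_EFinP.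
  - by move=> y _; rewrite lee_fin; exact/lefP/nd_nnsfun_approx.
rewrite limeMl//; last exact: ereal_nondecreasing_is_cvgn.
congr (_ * _)%E; rewrite -monotone_convergence//; last 3 first.
- by move=> n; exact/measurable_EFinP.
- by move=> n x _; rewrite lee_fin.
- by move=> y _ a b ab; rewrite lee_fin; exact/lefP/nd_nnsfun_approx.
by apply: eq_integral => y _; apply/cvg_lim => //; exact: hf.
Qed.

End weighted_law.

(** * Product formula for independent variables *)

Section independence.
Context d (T : measurableType d) (R : realType) (P : probability T R).

Lemma prodEFin (I : finType) (J : pred I) (x : I -> R) :
  (\big[mule/1]_(i | J i) (x i)%:E = (\prod_(i | J i) x i)%:E)%E.
Proof. by elim/big_rec2: _ => // i y1 y2 _ ->; rewrite EFinM. Qed.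

(** Meant for [A] a rectangle in the coordinates of z and [Y] the entries of X, so that the
    independence of z and X and that among the entries are used together. *)
Lemma integral_indep_prod (I : finType) (Y : I -> {RV P >-> R}) (A : set T)
    (f : I -> R -> R) (m : I -> R) :
  measurable A ->
  (forall B : I -> set R, (forall i, measurable (B i)) ->
    P (A `&` \bigcap_i (Y i @^-1` B i)) =
    (fine (P A) * \prod_i fine (P (Y i @^-1` B i)))%:E) ->
  (forall i, measurable_fun setT (f i)) -> (forall i y, 0 <= f i y) ->
  (forall i, \int[P]_w (f i (Y i w))%:E = (m i)%:E)%E ->
  (\int[P]_w (\1_A w * \prod_i f i (Y i w))%:E =
   (fine (P A) * \prod_i m i)%:E)%E.
Proof.
move=> mA indep mf f0 fm.
(* By induction on s, a list outside of which every f i is an indicator: the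
   case of indicators f j determines the law of Y j weighted by the product of
   the other factors, and hence the case of general f j. *)
suff H (s : seq I) : uniq s -> forall (f : I -> R -> R) (m : I -> R),
    (forall i, measurable_fun setT (f i)) -> (forall i y, 0 <= f i y) ->
    (forall i, \int[P]_w (f i (Y i w))%:E = (m i)%:E)%E ->
    (forall i, i \notin s -> exists2 B, measurable B & f i = \1_B) ->
    (\int[P]_w (\1_A w * \prod_i f i (Y i w))%:E =
     (fine (P A) * \prod_i m i)%:E)%E.
  by apply: (H (enum I)) => //; [exact: enum_uniq|move=> i; rewrite mem_enum].
have preim i B : measurable B -> measurable (Y i @^-1` B).
  by move=> mB; rewrite -[_ @^-1` _]setTI; exact: measurable_funP.
have int1 i B : measurable B ->
    (\int[P]_w (\1_B (Y i w))%:E = (fine (P (Y i @^-1` B)))%:E :> \bar R)%E.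
  move=> mB; rewrite fineK ?fin_num_measure//; last exact: preim.
  rewrite -[in RHS](setIT (_ @^-1` _)) -(integral_indic P measurableT) ?preim//.
  exact: preim.
elim: s => [_|j s IH /= /andP[js us]] {f m mf f0 fm} f m mf f0 fm fB.
  have {fB} /choice[B BE] i : exists B, measurable B /\ f i = \1_B.
    by have [B mB fE] := fB i isT; exists B.
  have mB i : measurable (B i) by case: (BE i).
  have -> : \prod_i m i = \prod_i fine (P (Y i @^-1` B i)).
    apply: eq_bigr => i _; apply: EFin_inj; rewrite -fm -int1//.
    by case: (BE i) => _ ->.
  have mAB : measurable (A `&` \bigcap_i (Y i @^-1` B i)).
    apply: measurableI => //; apply: fin_bigcap_measurable => // i _.
    exact: preim.
  rewrite -indep// -[in RHS](setIT (A `&` _)) -(integral_indic P measurableT)//.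
  apply: eq_integral => w _; congr (_%:E); rewrite !indicE.
  have [ABw|ABw] := boolP (w \in _ `&` _).
    move: ABw; rewrite inE => -[Aw Bw]; rewrite mem_set// mul1r.
    apply: big1 => i _; case: (BE i) => _ ->.
    by rewrite indicE mem_set//; exact: Bw.
  have [Aw|_] := boolP (w \in A); last by rewrite mul0r.
  rewrite mul1r; apply/eqP/prodf_eq0.
  have [i Bi] : exists i, ~ B i (Y i w).
    apply/existsNP => Bw; move/negP: ABw; apply; rewrite inE; split.
      by rewrite inE in Aw.
    by move=> i _; exact: Bw.
  by exists i => //; case: (BE i) => _ ->; rewrite indicE memNset.
set c := fine (P A) * \prod_(i | i != j) m i.
set g := fun w => \1_A w * \prod_(i | i != j) f i (Y i w).
have m0 i : 0 <= m i.
  by rewrite -lee_fin -fm; apply: integral_ge0 => w _; rewrite lee_fin.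
have mfY i : measurable_fun setT (fun w => f i (Y i w)).
  by apply: measurableT_comp.
transitivity (\int[P]_w (f j (Y j w) * g w)%:E)%E.
  apply: eq_integral => w _.
  by rewrite /g [in LHS](bigD1 j)//= mulrCA.
rewrite (@weighted_law _ _ _ _ R P (distribution P (Y j)) (Y j) g c)//.
- rewrite ge0_integral_distribution//=; last 2 first.
  + exact/measurable_EFinP.
  + by move=> y; rewrite lee_fin.
  by rewrite fm -EFinM /c [in RHS](bigD1 j)//= mulrAC -mulrA.
- apply: measurable_funM; first exact: measurable_indic.
  by under eq_fun do rewrite -big_filter; apply: measurable_prod => i _.
- by move=> w; rewrite /g mulr_ge0 ?prodr_ge0//.
move=> B mB.
(* Once the factor [j] is an indicator, the induction hypothesis for [s] applies. *)
pose f' i := if i == j then \1_B else f i.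
pose m' i := if i == j then fine (P (Y i @^-1` B)) else m i.
have /= := IH us f' m'.
rewrite (bigD1 j)//= {2}/m' eqxx.
under [X in (_ * (_ * X))%:E]eq_bigr => i /negPf ij do rewrite /m' ij.
rewrite /distribution/= /pushforward.
have -> : (c%:E * P (Y j @^-1` B) =
  (fine (P A) * (fine (P (Y j @^-1` B)) * \prod_(i | i != j) m i))%:E)%E.
  rewrite /c !EFinM !fineK ?fin_num_measure//; last exact: preim.
  by rewrite -muleA; congr (_ * _)%E; rewrite muleC.
move=> <-.
- apply: eq_integral => w _; rewrite /g [in RHS](bigD1 j)//= {1}/f' eqxx mulrCA.
  congr (_ * (_ * _))%:E; apply: eq_bigr => i /negPf ij.
  by rewrite /f' ij.
- by move=> i; rewrite /f'; case: ifP => // _; exact: measurable_indic.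
- by move=> i y; rewrite /f'; case: ifP.
- move=> i; rewrite /f' /m'; case: ifPn => // /eqP ->; exact: int1.
- move=> i ins; rewrite /f'; case: ifPn => ij; first by exists B.
  by apply: fB; rewrite inE negb_or ij.
Qed.

End independence.

(** * Finite means, Markov's inequality and the Gaussian exponential moment *)

Section has_mean.
Context d (T : measurableType d) (R : realType) (P : probability T R).

(** Integrability is included so that means can be combined with negative coefficients, as occur in
    [weight_coef]. *)
Definition has_mean (Y : T -> R) (m : R) :=
  P.-integrable setT (EFin \o Y) /\ (\int[P]_w (Y w)%:E = m%:E)%E.

Lemma ge0_has_mean (Y : T -> R) (m : R) : measurable_fun setT Y ->
  (forall w, 0 <= Y w) -> (\int[P]_w (Y w)%:E = m%:E)%E -> has_mean Y m.
Proof.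
move=> mY Y0 Ym; split => //; apply/integrableP; split.
  exact/measurable_EFinP.
under eq_integral do rewrite gee0_abs ?lee_fin//.
by rewrite Ym ltry.
Qed.

Lemma has_meanZ (c : R) (Y : T -> R) (m : R) :
  has_mean Y m -> has_mean (fun w => c * Y w) (c * m).
Proof.
move=> [iY Ym]; split.
  rewrite (_ : _ \o _ = fun w => c%:E * (EFin \o Y) w)%E; first exact: integrableZl.
  by apply/funext => w /=; rewrite EFinM.
under eq_integral do rewrite EFinM.
by rewrite integralZl// Ym EFinM.
Qed.

Lemma has_mean_sum (I : finType) (Y : I -> T -> R) (m : I -> R) :
  (forall i, has_mean (Y i) (m i)) ->
  has_mean (fun w => \sum_i Y i w) (\sum_i m i).
Proof.
move=> Ym; split.
  rewrite (_ : _ \o _ = fun w => \sum_i (EFin \o Y i) w)%E.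
    by apply: integrable_sum => // i _; case: (Ym i).
  by apply/funext => w /=; rewrite sumEFin.
under eq_integral do rewrite -sumEFin.
rewrite integral_sum//; last by move=> i; case: (Ym i).
by rewrite -sumEFin; apply: eq_bigr => i _; case: (Ym i).
Qed.

Lemma has_meanD (Y1 Y2 : T -> R) (m1 m2 : R) :
  has_mean Y1 m1 -> has_mean Y2 m2 ->
  has_mean (fun w => Y1 w + Y2 w) (m1 + m2).
Proof.
move=> h1 h2.
have := @has_mean_sum _ (fun b : bool => if b then Y1 else Y2)
  (fun b => if b then m1 else m2).
rewrite !big_bool/=.
rewrite (_ : (fun w => _) = (fun w => Y1 w + Y2 w)); first by apply; case.
by apply/funext => w; rewrite big_bool.
Qed.

Lemma has_mean_markov (Y : T -> R) (m : R) : has_mean Y m ->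
  (forall w, 0 <= Y w) ->
  measurable [set w | Y w < 1] /\ ((1 - m)%:E <= P [set w | Y w < 1]%R)%E.
Proof.
move=> [iY Ym] Y0.
have mY : measurable_fun setT Y by exact/measurable_EFinP/measurable_int/iY.
have mY1 : measurable [set w | 1 <= Y w].
  rewrite -[X in measurable X]setTI.
  rewrite (_ : [set w | _] = Y @^-1` `[1, +oo[); first exact: mY.
  by apply/seteqP; split => w /=; rewrite in_itv/= andbT.
have -> : [set w | Y w < 1] = ~` [set w | 1 <= Y w].
  by apply/seteqP; split => w /=; rewrite ltNge => /negP.
split; first exact: measurableC.
rewrite probability_setC// EFinB leeB// -Ym.
rewrite -[leLHS](_ : \int[P]_w (\1_[set w | (1 <= Y w)%R] w)%:E = _)%E; last first.
  by rewrite integral_indic// setIT.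
apply: ge0_le_integral => //.
- exact/measurable_EFinP/measurable_indic.
- exact/measurable_EFinP.
move=> w _; rewrite lee_fin indicE; case: (boolP (w \in _)) => [|//].
by rewrite inE.
Qed.

(** Completing the square: exp(a x) times the N(0,1) density is exp(a^2 / 2) times the N(a,1)
    density, which integrates to 1. *)
Lemma normal_mgf (X : {RV P >-> R}) (a : R) :
  (forall A : set R, measurable A -> distribution P X A = normal_prob 0 1 A) ->
  (\int[P]_w (expR (a * X w))%:E = (expR (a ^+ 2 / 2))%:E)%E.
Proof.
move=> lawX.
have mexp : measurable_fun setT (fun x : R => expR (a * x)).
  by apply: measurableT_comp => //; exact: measurable_funM.
transitivity (\int[distribution P X]_x (expR (a * x))%:E)%E.
  rewrite ge0_integral_distribution//.
  exact/measurable_EFinP.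
have := @weighted_law _ _ _ _ R lebesgue_measure (distribution P X) id
  (normal_pdf 0 1) 1 _ _ _ _ _ mexp.
rewrite mul1e => <-//; last 3 first.
- exact: measurable_normal_pdf.
- by move=> x; exact: normal_pdf_ge0.
- move=> A mA; rewrite mul1e.
  transitivity (normal_prob 0 1 A); last exact/esym/lawX.
  rewrite /normal_prob [in RHS]integral_mkcond.
  apply: eq_integral => x _; rewrite patchE indicE.
  by case: ifPn => _; rewrite (mul1r, mul0r).
transitivity (\int[lebesgue_measure]_x
    ((expR (a ^+ 2 / 2))%:E * (normal_pdf a 1 x)%:E))%E.
  apply: eq_integral => x _; rewrite -EFinM; congr (_%:E).
  rewrite !normal_pdfE ?oner_eq0// /normal_fun mulrCA [RHS]mulrCA -!expRD.
  congr (_ * expR _); by rewrite expr1n; field.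
transitivity ((expR (a ^+ 2 / 2))%:E *
    \int[lebesgue_measure]_x (normal_pdf a 1 x)%:E)%E.
  apply: ge0_integralZl_EFin => //.
  - by move=> x _; rewrite lee_fin normal_pdf_ge0.
  - by apply/measurable_EFinP; exact: measurable_normal_pdf.
by rewrite integral_normal_pdf mule1.
Qed.

End has_mean.

(** * Joint exponential moments of X and z *)

Section gaussian_moments.
Context d (T : measurableType d) (R : realType) (P : probability T R).

Lemma var_events_bigcap (I : finType) (Y : I -> {RV P >-> R}) (B : I -> set R)
    (F : set (set T)) :
  (forall i, measurable (B i)) -> var_events Y `<=` F ->
  <<s F >> (\bigcap_i Y i @^-1` B i).
Proof.
move=> mB YF.
suff : @measurable _ (g_sigma_algebraType F) (\bigcap_i Y i @^-1` B i) by [].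
apply: fin_bigcap_measurable => // i _.
apply: sub_gen_smallest; apply: YF; exists i => //.
by exists (B i) => //; rewrite setTI.
Qed.

Lemma mutually_independentT (I : finType) (Y : I -> {RV P >-> R})
    (B : I -> set R) : mutually_independent Y ->
  (forall i, measurable (B i)) ->
  P (\bigcap_i Y i @^-1` B i) = (\prod_i fine (P (Y i @^-1` B i)))%:E.
Proof.
move=> indY mB; have := indY [set: I]%SET B (fun i _ => mB i).
rewrite (_ : [set` _] = setT); last by apply/seteqP; split => i //= _; rewrite inE.
move=> ->; rewrite -prodEFin; apply: eq_big => [i|i _]; first by rewrite inE.
rewrite fineK// fin_num_measure// -[_ @^-1` _]setTI.
exact: measurable_funP.
Qed.

Variables (n p : nat) (X : 'I_n -> 'I_p -> {RV P >-> R}) (z : 'I_p -> {RV P >-> R}).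
Variable F : set (set T).
Hypothesis indX : mutually_independent (fun ij : 'I_n * 'I_p => X ij.1 ij.2).
Hypothesis lawX : forall i j (A : set R), measurable A ->
  distribution P (X i j) A = normal_prob 0 1 A.
Hypothesis indz : mutually_independent z.
Hypothesis indXz : independent_classes P <<s var_events z >>
  <<s var_events (fun ij : 'I_n * 'I_p => X ij.1 ij.2) `|` F >>.

(** The product of indicators is the indicator of a rectangle event of z, whose probability factors
    out; each Gaussian entry then contributes its own exponential moment. *)
Lemma exp_moment (B : 'I_p -> set R) (a : 'I_n * 'I_p -> R) :
  (forall j, measurable (B j)) ->
  has_mean P
    (fun w => (\prod_j \1_(B j) (z j w)) * expR (\sum_ij a ij * X ij.1 ij.2 w))
    ((\prod_j fine (P (z j @^-1` B j))) * expR (\sum_ij a ij ^+ 2 / 2)).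
Proof.
move=> mB.
have mz j : measurable (z j @^-1` B j).
  by rewrite -[_ @^-1` _]setTI; exact: measurable_funP.
have mexp ij : measurable_fun setT (fun x : R => expR (a ij * x)).
  by apply: measurableT_comp => //; exact: measurable_funM.
set A := \bigcap_j z j @^-1` B j.
have mA : measurable A by exact: fin_bigcap_measurable.
have PA : fine (P A) = \prod_j fine (P (z j @^-1` B j)).
  by rewrite mutually_independentT.
have AE w : \1_A w = \prod_j \1_(B j) (z j w) :> R.
  rewrite indicE; have [Aw|Aw] := boolP (w \in A).
    move: Aw; rewrite inE => Aw; rewrite big1// => j _.
    by rewrite indicE mem_set//; exact: Aw.
  apply/esym/eqP/prodf_eq0.
  have [j Bj] : exists j, ~ B j (z j w).
    by apply/existsNP => Bw; move/negP: Aw; apply; rewrite inE => j _; exact: Bw.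
  by exists j => //; rewrite indicE memNset.
apply: ge0_has_mean.
- apply: measurable_funM.
    apply: measurable_prod => j _; apply: measurableT_comp => //.
  apply: measurableT_comp => //; apply: measurable_sum => ij.
  exact: measurable_funM.
- by move=> w; rewrite mulr_ge0 ?expR_ge0// prodr_ge0.
under eq_integral => w _ do rewrite -AE expR_sum.
rewrite (@integral_indep_prod _ _ _ P _ (fun ij : 'I_n * 'I_p => X ij.1 ij.2) A
  (fun ij x => expR (a ij * x)) (fun ij => expR (a ij ^+ 2 / 2)))//.
- by rewrite PA expR_sum.
- move=> C mC; rewrite indXz.
  + by rewrite mutually_independentT// EFinM fineK// fin_num_measure.
  + exact: var_events_bigcap.
  + by apply: var_events_bigcap => // ? ?; left.
- by move=> ij; apply: normal_mgf => C mC; exact: lawX.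
Qed.

Lemma gaussian_mgf (a : 'I_n * 'I_p -> R) :
  has_mean P (fun w => expR (\sum_ij a ij * X ij.1 ij.2 w))
    (expR (\sum_ij a ij ^+ 2 / 2)).
Proof.
have := @exp_moment (fun=> setT) a (fun=> measurableT).
rewrite big1 ?mul1r; last by move=> j _; rewrite preimage_setT probability_setT.
congr (has_mean P _ _); apply/funext => w.
by rewrite big1 ?mul1r// => j _; rewrite indicT.
Qed.

(* Expanding the product over j of the sums over k turns every factor into a
   product of functions of the independent entries. *)
Lemma prod_exp_moment (K : finType) (c : K -> R) (B : K -> set R) (s : K -> R)
    (v : 'I_n -> R) :
  (forall k, measurable (B k)) -> \sum_i v i ^+ 2 = 1 ->
  has_mean P
    (fun w => \prod_j \sum_k c k * \1_(B k) (z j w) *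
      expR (s k * \sum_i v i * X i j w))
    (\prod_j \sum_k c k * fine (P (z j @^-1` B k)) * expR (s k ^+ 2 / 2)).
Proof.
move=> mB v1; rewrite bigA_distr_bigA.
under [X in has_mean _ X]eq_fun do rewrite bigA_distr_bigA.
apply: has_mean_sum => f.
have := has_meanZ (\prod_j c (f j)) (@exp_moment (fun j => B (f j))
  (fun ij => s (f ij.2) * v ij.1) (fun j => mB (f j))).
congr (has_mean P _ _).
  apply/funext => w; rewrite mulrA -big_split/= [RHS]big_split/=; congr (_ * _).
  rewrite -expR_sum; congr expR.
  rewrite -(pair_bigA _ (fun i j => s (f j) * v i * X i j w))/= exchange_big/=.
  by apply: eq_bigr => j _; rewrite mulr_sumr; apply: eq_bigr => i _; rewrite mulrA.
rewrite mulrA -big_split/= [RHS]big_split/=; congr (_ * _).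
rewrite -expR_sum; congr expR.
rewrite -(pair_bigA _ (fun i j => (s (f j) * v i) ^+ 2 / 2))/= exchange_big/=.
(* As v is a unit vector, <x_j, v> has variance 1. *)
apply: eq_bigr => j _; rewrite -[RHS]mulr1 -v1 mulr_sumr; apply: eq_bigr => i _.
by rewrite exprMn mulrAC.
Qed.

End gaussian_moments.

(** * Scalar inequalities and the one-column bound *)

Section scalar_bounds.
Context (R : realType).
Implicit Types l t z q : R.

(** Follows from exp(- s) <= 1 / (1 + s) and (1 - s + s^2) (1 + s) = 1 + s^3. *)
Lemma expRN_le_quad (s : R) : 0 <= s -> expR (- s) <= 1 - s + s ^+ 2.
Proof.
move=> s0; rewrite expRN; have s1 := expR_ge1Dx s.
rewrite -div1r ler_pdivrMr ?expR_gt0//.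
apply: (@le_trans _ _ ((1 - s + s ^+ 2) * (1 + s))); last by rewrite ler_wpM2l//; nra.
rewrite [leRHS](_ : _ = 1 + s ^+ 3); last by ring.
by rewrite lerDl exprn_ge0.
Qed.

Lemma expR_half_bounds : 3 / 2 <= expR (1 / 2 : R) <= 2.
Proof.
apply/andP; split; first by apply: le_trans (expR_ge1Dx _); lra.
have := expR_ge1Dx (- (1 / 2) : R); rewrite expRN => h.
have e0 := expR_gt0 (1 / 2 : R).
by rewrite -[leLHS]invrK invf_ple ?posrE ?invr_gt0//; lra.
Qed.

Lemma expR_small_le l : 0 <= l <= 1 -> expR (l ^+ 2 / 2) <= 1 + l ^+ 2.
Proof.
move=> /andP[l0 l1]; set s := l ^+ 2 / 2.
have s2 : l ^+ 2 = 2 * s by rewrite /s; field.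
have l2 : 0 <= l ^+ 2 <= 1 by rewrite exprn_ge0//= expr_le1.
have := expR_ge1Dx (- s); rewrite expRN => h.
have e0 := expR_gt0 s; have : (1 - s) * expR s <= 1.
  by rewrite -ler_pdivlMr// div1r.
nra.
Qed.

(* The right-hand side combines exponentials of t, whose Gaussian means are
   explicit. It comes from exp(- s) <= 1 - s + s^2 at s = l |t|, the bound
   |t| >= ((cosh t - 1) - (cosh 2t - 1) / 30) / 4, and t^2 <= 2 (e^t + e^-t). *)
Lemma expRN_norm_le l t : 0 <= l -> expR (- (l * `|t|)) <=
  (1 + 29 / 120 * l) + (2 * l ^+ 2 - l / 8) * (expR t + expR (- t)) +
  l / 240 * (expR (2 * t) + expR (- (2 * t))).
Proof.
move=> l0.
wlog t0 : t / 0 <= t.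
  move=> H; case: (leP 0 t) => [|t0]; first exact: H.
  have := H (- t); rewrite normrN mulrN !opprK addrC [in X in _ -> X]addrC.
  rewrite [expR (- t) + _]addrC [expR (- (2 * t)) + _]addrC => -> //.
  by rewrite oppr_ge0 ltW.
rewrite ger0_norm//; apply: (le_trans (expRN_le_quad _)); first exact: mulr_ge0.
set y := expR t.
have y1 : 1 <= y by rewrite /y -expR0 ler_expR.
have y0 : 0 < y by rewrite expR_gt0.
have yN : expR (- t) = y^-1 by rewrite expRN.
have y2 : expR (2 * t) = y ^+ 2 by rewrite expRM_natl.
have y2N : expR (- (2 * t)) = y^-1 ^+ 2 by rewrite expRN y2 exprVn.
rewrite yN y2 y2N.
have ty : 1 - y^-1 <= t by rewrite -yN; have := expR_ge1Dx (- t); lra.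
have t2 : t ^+ 2 <= 2 * y.
  by have := @expR_ge1Dxn R t 1 t0; rewrite -/y (_ : 2`! = 2)//; lra.
set u := y^-1 in ty *; have uy : u * y = 1 by rewrite mulVf// gt_eqF.
have u0 : 0 < u by rewrite invr_gt0.
have u1 : u <= 1 by rewrite invf_le1.
(* The lower bound for |t|, strengthened by replacing t with 1 - u <= t. The difference has the
   factor y - 1 and a cubic, positive since y^2 - 29 y + 269 = (y - 29/2)^2 + 235/4. *)
have key : (y + u) / 8 - (y ^+ 2 + u ^+ 2) / 240 - 29 / 120 <= 1 - u.
  rewrite -subr_ge0.
  have -> : 1 - u - ((y + u) / 8 - (y ^+ 2 + u ^+ 2) / 240 - 29 / 120) =
    (y - 1) * (y ^+ 3 - 29 * y ^+ 2 + 269 * y - 1) / 240 * u ^+ 2.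
    have -> : u = y^-1 by [].
    by field; rewrite gt_eqF.
  apply: mulr_ge0; last by rewrite exprn_ge0// ltW.
  apply: divr_ge0; [apply: mulr_ge0|by rewrite ler0n]; first by rewrite subr_ge0.
  have : 0 <= (y - 29 / 2) ^+ 2 by rewrite sqr_ge0.
  nra.
have := ler_wpM2l l0 (le_trans key ty).
have := ler_wpM2l (sqr_ge0 l) t2.
have : 0 <= l ^+ 2 * u by apply: mulr_ge0; [exact: sqr_ge0|exact: ltW].
rewrite exprMn; lra.
Qed.

(* The directional derivative of the absolute value at z along - t. *)
Definition gain z t := if z == 0 then `|t| else - Num.sg z * t.

(** Convexity of the absolute value: for nonzero z, test z - t against the sign of z. *)
Lemma norm_ge_gain z t : `|z| + gain z t <= `|z - t|.
Proof.
rewrite /gain; case: eqVneq => [->|z0]; first by rewrite normr0 add0r sub0r normrN.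
rewrite mulNr [`|z|]normrEsg -mulrBr.
by apply: le_trans (ler_norm _) _; rewrite normrM normr_sg z0 mul1r.
Qed.

Lemma gain_lip z t t' : gain z t - `|t'| <= gain z (t + t').
Proof.
rewrite /gain; case: eqVneq => [_|z0].
  by have := ler_normB (t + t') t'; rewrite addrK lerBlDr.
rewrite mulrDr lerD2l mulNr lerN2.
by apply: le_trans (ler_norm _) _; rewrite normrM normr_sg z0 mul1r.
Qed.

Lemma gainZ z t (c : R) : 0 <= c -> gain z (c * t) = c * gain z t.
Proof.
move=> c0; rewrite /gain; case: ifP => _; last by rewrite mulrCA.
by rewrite normrM ger0_norm.
Qed.

(* The first five indices encode the bound expRN_norm_le on the atom z = 0, the
   last two the exponentials e^(l t) on z > 0 and e^(- l t) on z < 0. *)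
Definition weight_set (k : 'I_7) : set R :=
  if (k < 5)%N then [set 0] else if k == 5 :> nat then [set` `]0, +oo[]
  else [set` `]-oo, 0[].

Definition weight_coef l (k : 'I_7) : R :=
  nth 0 [:: 1 + 29 / 120 * l; 2 * l ^+ 2 - l / 8; 2 * l ^+ 2 - l / 8;
            l / 240; l / 240; 1; 1] k.

Definition weight_exp l (k : 'I_7) : R :=
  nth 0 [:: 0; 1; -1; 2; -2; l; - l] k.

Definition weight l z t : R :=
  \sum_k weight_coef l k * \1_(weight_set k) z * expR (weight_exp l k * t).

Lemma weight_ge l z t : 0 <= l -> expR (- (l * gain z t)) <= weight l z t.
Proof.
move=> l0; rewrite /weight !big_ord_recl big_ord0.
rewrite /weight_coef /weight_set /weight_exp /= !indicE.
rewrite !mem_setE !in_itv/= andbT.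
rewrite (_ : (z \in [set 0]) = (z == 0)); last first.
  by apply/idP/eqP; rewrite inE.
rewrite /gain; case: (ltgtP z 0) => z0.
- by rewrite ltr0_sg// !mulr0 !mul0r !add0r addr0 !mul1r opprK mul1r mulNr.
- by rewrite gtr0_sg// !mulr0 !mul0r !add0r !addr0 !mul1r !mulN1r mulrN opprK.
rewrite !mulr1 !mulr0 !mul0r expR0 !mul1r !mulN1r mulNr.
apply: (le_trans (expRN_norm_le t l0)); rewrite le_eqVlt; apply/orP; left.
by apply/eqP; ring.
Qed.

End scalar_bounds.

Section weight_mean.
Context (R : realType).
Implicit Types l q : R.

(** The sum is the mean of [weight] when z has masses q0, qp, qm at 0, above 0 and below 0, and t is
    standard Gaussian. The atom gives a negative slope in l; elsewhere the linear term has mean 0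
    and only l^2 is lost. Nonnegativity allows these bounds to be multiplied over the columns. *)
Lemma weight_mean_le l q q0 qp qm (r : 'I_7 -> R) : 0 <= l <= 1 ->
  (forall k : 'I_7,
    r k = if (k < 5)%N then q0 else if k == 5 :> nat then qp else qm) ->
  0 <= q <= q0 -> 0 <= qp + qm -> q0 + (qp + qm) = 1 ->
  0 <= \sum_k weight_coef l k * r k * expR (weight_exp l k ^+ 2 / 2) <=
  expR (8 * l ^+ 2 - q * l / 16).
Proof.
move=> l01 rE /andP[q_ge0 qq0] qpm q1.
have q01 : q0 <= 1 by lra.
rewrite !big_ord_recl big_ord0 !rE /weight_coef /weight_exp/=.
rewrite expr0n mul0r expR0 !sqrrN expr1n.
have -> : 2 ^+ 2 / 2 = 4 * (1 / 2) :> R by rewrite expr2; field.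
rewrite (expRM_natl 4).
have /andP[] := expR_half_bounds R; set x := expR (1 / 2) => x1 x2.
have := expR_small_le l01; set y := expR (l ^+ 2 / 2) => yl.
case/andP: l01 => l0 l1.
(* The coefficient of l on the atom. As 3/2 <= x <= 2, both x - 1 and 1 - (1 + x + x^2 + x^3) / 30
   are at least 1/2. *)
have H1 : 29 / 120 - x / 4 + x ^+ 4 / 120 <= - (1 / 16).
  have -> : 29 / 120 - x / 4 + x ^+ 4 / 120 =
    - (1 / 4) * ((x - 1) * (1 - (1 + x + x ^+ 2 + x ^+ 3) / 30)) by field.
  have x22 : x ^+ 2 <= 4 by nra.
  have x3 : x ^+ 3 <= 8 by rewrite exprS; nra.
  nra.
have ql : q * l <= q0 * l by rewrite ler_wpM2r.
have H2 := ler_wpM2l (mulr_ge0 (le_trans q_ge0 qq0) l0) H1.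
have l2 : 0 <= l ^+ 2 := sqr_ge0 l.
have H3 : q0 * l ^+ 2 * x <= q0 * l ^+ 2 * 2.
  by rewrite ler_wpM2l// mulr_ge0// (le_trans q_ge0).
have H4 : (1 - q0) * y <= (1 - q0) * (1 + l ^+ 2) by rewrite ler_wpM2l// subr_ge0.
have H5 : 0 <= (1 - q0) * l ^+ 2 by rewrite mulr_ge0// subr_ge0.
have -> : qm = 1 - q0 - qp by lra.
have H6 : 0 <= q0 * l ^+ 2 by rewrite mulr_ge0// (le_trans q_ge0).
apply/andP; split; last by apply: le_trans (expR_ge1Dx _); lra.
have x0 : 0 <= x := expR_ge0 _.
have q00 : 0 <= q0 := le_trans q_ge0 qq0.
have H7 : 0 <= q0 * l ^+ 2 * x by exact: mulr_ge0.
have H8 : 0 <= q0 * l * x ^+ 4 by rewrite mulr_ge0 ?exprn_ge0 ?mulr_ge0.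
have H9 : q0 * (l * x) <= q0 * 2.
  by rewrite ler_wpM2l// (le_trans (ler_piMl x0 l1)).
have H10 : 0 <= (1 - q0) * y by rewrite mulr_ge0 ?subr_ge0// expR_ge0.
have H11 : 0 <= q0 * l by exact: mulr_ge0.
lra.
Qed.

End weight_mean.

(** * A grid net for the unit sphere *)

Section net.
Context (R : realType) (n N : nat).

(** Integer grid points, each coordinate coded by a sign bit and an absolute value; the mesh enters
    only through the scale K sqrt n. *)
Definition net : finType := {ffun 'I_n -> bool * 'I_N}.

Implicit Type k : net.

Definition net_pt k i : R := (-1) ^+ (k i).1 * ((k i).2 : nat)%:R.

Definition net_norm k : R := Num.sqrt (\sum_i net_pt k i ^+ 2).

Definition net_dir k i : R := net_pt k i / net_norm k.

(** The l1 norm of the grid point. With N of order K sqrt n the whole grid has of order (K sqrt n)^n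
    points up to a factor C^n, but those of cost at most K n number only (C K)^n. *)
Definition net_cost k : R := \sum_i ((k i).2 : nat)%:R.

Lemma net_dir_unit k : net_norm k != 0 -> \sum_i net_dir k i ^+ 2 = 1.
Proof.
move=> k0; under eq_bigr do rewrite expr_div_n.
rewrite -mulr_suml sqr_sqrtr; last by rewrite sumr_ge0// => i _; exact: sqr_ge0.
rewrite mulfV//; apply: contraNneq k0 => k0.
by rewrite /net_norm k0 sqrtr0.
Qed.

(* Rounding towards 0 keeps the l1 norm of the rounded point below K n. *)
Lemma net_approx (K : R) (v : 'I_n -> R) : (0 < n)%N -> 2 <= K ->
  K * Num.sqrt n%:R < N%:R -> \sum_i v i ^+ 2 = 1 ->
  exists k, [/\ net_cost k <= K * n%:R, K * Num.sqrt n%:R / 2 <= net_norm k &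
    forall i, `|v i - net_pt k i / (K * Num.sqrt n%:R)| <=
              (K * Num.sqrt n%:R)^-1].
Proof.
move=> n0 K2 KN v1; set S := K * Num.sqrt n%:R in KN *.
have sn0 : 0 < Num.sqrt n%:R :> R by rewrite sqrtr_gt0 ltr0n.
have sn2 : Num.sqrt n%:R ^+ 2 = n%:R :> R by rewrite sqr_sqrtr.
have K0 : 0 < K by apply: lt_le_trans K2.
have S0 : 0 < S by rewrite mulr_gt0.
have Sv i : 0 <= S * `|v i| by rewrite mulr_ge0// ltW.
have vi1 i : `|v i| <= 1.
  rewrite -(@expr_le1 _ 2)// real_normK ?num_real// -v1 (bigD1 i)//= lerDl.
  by rewrite sumr_ge0// => j _; exact: sqr_ge0.
have mN i : (Num.truncn (S * `|v i|) < N)%N.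
  rewrite truncn_lt_nat//; apply: le_lt_trans KN.
  by rewrite ler_piMr// ltW.
pose k : net := [ffun i => (v i < 0, Ordinal (mN i))].
have m_le i : (Num.truncn (S * `|v i|))%:R <= S * `|v i| by rewrite truncn_le.
have err i : `|v i - net_pt k i / S| <= S^-1.
  rewrite /net_pt ffunE/= {1}[v i]numEsign -mulrA -mulrBr normrM normrX normrN1.
  rewrite expr1n mul1r; have /andP[] := truncn_itv (Sv i); rewrite -natr1.
  set m := (Num.truncn _)%:R => m1 m2.
  have -> : `|v i| - m / S = (S * `|v i| - m) / S.
    by rewrite mulrBl mulrAC mulfV ?gt_eqF// mul1r.
  rewrite normrM [`|S^-1|]gtr0_norm ?invr_gt0//.
  rewrite ler_piMl ?invr_ge0 ?(ltW S0)//.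
  by rewrite ger0_norm ?subr_ge0// lerBlDl ltW.
exists k; split => //.
  (* Here sqrt n |v_i| <= (1 + n v_i^2) / 2, which sums to n. *)
  apply: (@le_trans _ _ (\sum_i K * ((1 + n%:R * v i ^+ 2) / 2))).
    apply: ler_sum => i _; rewrite ffunE/=; apply: (le_trans (m_le i)).
    rewrite /S -mulrA ler_wpM2l ?(ltW K0)// -[X in 1 + X * _]sn2.
    rewrite -[v i ^+ 2]real_normK ?num_real//.
    rewrite -exprMn; set a := _ * `|v i|.
    by have := sqr_ge0 (a - 1); lra.
  rewrite -mulr_sumr ler_wpM2l ?(ltW K0)// -mulr_suml big_split/= -mulr_sumr v1.
  by rewrite sumr_const card_ord mulr1; lra.
(* From a^2 <= 2 b^2 + 2 (a - b)^2. The squared errors sum to at most n / S^2 = 1 / K^2 <= 1/4,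
   which leaves the rounded point a norm of at least 1/2 after scaling. *)
have : \sum_i v i ^+ 2 <=
    \sum_i (2 * (net_pt k i / S) ^+ 2 + 2 * S^-1 ^+ 2).
  apply: ler_sum => i _.
  have e2 : (v i - net_pt k i / S) ^+ 2 <= S^-1 ^+ 2.
    by rewrite -[leLHS]real_normK ?num_real// ler_sqr ?nnegrE ?invr_ge0 ?(ltW S0)//; exact: err.
  have := sqr_ge0 (v i - 2 * (net_pt k i / S)).
  by lra.
rewrite v1 big_split/= -!mulr_sumr sumr_const card_ord.
under eq_bigr do rewrite expr_div_n.
rewrite -mulr_suml => H.
have Sn : S^-1 ^+ 2 *+ n <= 1 / 4.
  rewrite /S invfM exprMn -mulr_natr -mulrA [in X in _ * X]exprVn sn2.
  rewrite mulVf ?mulr1 ?pnatr_eq0 -?lt0n//.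
  rewrite exprVn div1r lef_pV2 ?posrE ?exprn_gt0//; nra.
rewrite /net_norm -[leLHS]ger0_norm; last by rewrite divr_ge0// ltW.
rewrite -sqrtr_sqr ler_wsqrtr// exprMn -ler_pdivlMl ?exprn_gt0//.
rewrite [leRHS]mulrC exprVn; lra.
Qed.

End net.

(** * Counting the net, and passing from it to all vectors *)

Section gain_on_net.
Context (R : realType) (n p N : nat).

(* The summand is at least 1 when net_cost k <= K n, so this also bounds the
   number of such points. *)
Lemma net_weight_sum (K : R) : 0 < K ->
  \sum_(k : net n N) expR (n%:R - net_cost R k / K) <=
  (2 * expR 1 * (K + 1)) ^+ n.
Proof.
move=> K0; pose F (a : bool * 'I_N) : R := expR (1 - (a.2 : nat)%:R / K).
have -> : \sum_(k : net n N) expR (n%:R - net_cost R k / K) = \prod_(i < n) \sum_a F a.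
  rewrite bigA_distr_bigA; apply: eq_bigr => k _; rewrite /F -expR_sum; congr expR.
  by rewrite sumrB sumr_const card_ord -mulr_suml.
rewrite prodr_const card_ord lerXn2r ?nnegrE//.
- by apply: sumr_ge0 => a _; exact: expR_ge0.
- by rewrite !mulr_ge0 ?expR_ge0//; lra.
rewrite -(pair_bigA _ (fun (b : bool) (m : 'I_N) => F (b, m)))/= big_bool/=.
rewrite /F/=; suff : \sum_(m < N) expR (1 - m%:R / K) <= expR 1 * (K + 1) by lra.
set rho := expR (- K^-1).
have -> : \sum_(m < N) expR (1 - m%:R / K) = expR 1 * \sum_(m < N) rho ^+ m.
  rewrite mulr_sumr; apply: eq_bigr => m _.
  by rewrite -expRM_natl -expRD mulrN.
rewrite ler_wpM2l ?expR_ge0//.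
have rho0 : 0 < rho := expR_gt0 _.
(* That is, 1 / (1 - rho) <= K + 1, which bounds the geometric series independently of its length
   [N]. *)
have rhoK : (K + 1) * rho <= K.
  have := expR_ge1Dx K^-1; rewrite -[expR _]invrK -expRN -/rho => h.
  have : (1 + K^-1) * rho <= 1 by rewrite -ler_pdivlMr// div1r.
  move=> /(ler_wpM2l (ltW K0)); rewrite mulrA mulrDr mulfV ?gt_eqF// !mulr1.
  by [].
have := subrX1 rho N; set G := \sum_(_ < _) _ => GE.
have rhoN : 0 <= rho ^+ N by rewrite exprn_ge0 ?ltW.
have G0 : 0 <= G by apply: sumr_ge0 => m _; rewrite exprn_ge0 ?ltW.
have := ler_wpM2r G0 rhoK.
have : K * rho ^+ N >= 0 by rewrite mulr_ge0// ltW.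
nra.
Qed.

(* The l1 norm of X^T e is linear in e once the signs of the entries of X^T e
   are fixed, so over the cube |e_i| <= h it is largest at a vertex. *)
Lemma sum_norm_le_signs (x : 'I_n -> 'I_p -> R) (e : 'I_n -> R) (h : R) :
  (forall i, `|e i| <= h) ->
  exists (s : {ffun 'I_n -> bool}) (s' : {ffun 'I_p -> bool}),
    \sum_j `|\sum_i e i * x i j| <=
    h * \sum_ij (-1) ^+ s ij.1 * (-1) ^+ s' ij.2 * x ij.1 ij.2.
Proof.
move=> eh; pose s' := [ffun j => \sum_i e i * x i j < 0].
pose y i := \sum_j (-1) ^+ s' j * x i j; pose s := [ffun i => y i < 0].
exists s, s'.
rewrite -(pair_bigA _ (fun i j => (-1) ^+ s i * (-1) ^+ s' j * x i j))/=.
have -> : \sum_j `|\sum_i e i * x i j| = \sum_i e i * y i.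
  transitivity (\sum_j \sum_i e i * ((-1) ^+ s' j * x i j)).
    apply: eq_bigr => j _; rewrite normrEsign ffunE mulr_sumr.
    by apply: eq_bigr => i _; rewrite mulrCA.
  by rewrite exchange_big; apply: eq_bigr => i _; rewrite mulr_sumr.
rewrite mulr_sumr; apply: ler_sum => i _.
under eq_bigr do rewrite -mulrA.
rewrite -mulr_sumr -/(y i) ffunE -normrEsign.
apply: le_trans (ler_norm _) _.
by rewrite normrM ler_wpM2r.
Qed.

(** By homogeneity v may be taken of norm 1. Its rounding has norm at least 1/2, hence total gain
    above q p / 128; with K = 512 / q the rounding error costs less than 4 p / K = q p / 128. *)
Lemma gain_sum_gt0 (x : 'I_n -> 'I_p -> R) (z : 'I_p -> R) (q : R) :
  (0 < n)%N -> 0 < q <= 1 -> 512 / q * Num.sqrt n%:R < N%:R ->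
  (forall k : net n N, net_norm R k != 0 -> net_cost R k <= 512 / q * n%:R ->
    q * p%:R / 64 < \sum_j gain (z j) (\sum_i net_dir R k i * x i j)) ->
  (forall (s : {ffun 'I_n -> bool}) (s' : {ffun 'I_p -> bool}),
    \sum_ij (-1) ^+ s ij.1 * (-1) ^+ s' ij.2 * x ij.1 ij.2 <
    4 * p%:R * Num.sqrt n%:R) ->
  forall v : 'I_n -> R, \sum_i v i ^+ 2 != 0 ->
  0 < \sum_j gain (z j) (\sum_i v i * x i j).
Proof.
move=> n0 /andP[q0 q1] qN Hnet Hsign v v0.
set K := 512 / q in qN Hnet.
have Kq : K * q = 512 by rewrite /K mulfVK// gt_eqF.
have K0 : 0 < K by apply: divr_gt0 q0; rewrite ltr0n.
have K2 : 2 <= K by nra.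
set r := Num.sqrt n%:R in qN Hsign.
have r0 : 0 < r by rewrite sqrtr_gt0 ltr0n.
have sum2 : 0 <= \sum_i v i ^+ 2 by apply: sumr_ge0 => i _; exact: sqr_ge0.
pose nv := Num.sqrt (\sum_i v i ^+ 2).
have nv0 : 0 < nv by rewrite sqrtr_gt0 lt_neqAle eq_sym v0.
pose v1 i := v i / nv.
have v11 : \sum_i v1 i ^+ 2 = 1.
  under eq_bigr do rewrite expr_div_n.
  by rewrite -mulr_suml sqr_sqrtr// mulfV.
have vE j : \sum_i v i * x i j = nv * \sum_i v1 i * x i j.
  rewrite mulr_sumr; apply: eq_bigr => i _.
  by rewrite /v1 mulrA [nv * _]mulrC mulfVK ?gt_eqF.
under eq_bigr do rewrite vE gainZ ?(ltW nv0)//.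
rewrite -mulr_sumr mulr_gt0//.
have [k [kcost knorm kerr]] := net_approx n0 K2 qN v11.
set S := K * r in qN knorm kerr.
have S0 : 0 < S by rewrite mulr_gt0.
have norm0 : 0 < net_norm R k by apply: lt_le_trans knorm; rewrite divr_gt0.
have := Hnet k (lt0r_neq0 norm0) kcost.
set G := \sum_j _ => Gq.
pose u i := net_pt R k i / S; pose e i := v1 i - u i.
have [s [s' fe]] := sum_norm_le_signs x kerr.
have {}fe : \sum_j `|\sum_i e i * x i j| < q * p%:R / 128.
  apply: le_lt_trans fe _.
  have -> : q * p%:R / 128 = S^-1 * (4 * p%:R * r).
    rewrite /S invfM -(mulfK (lt0r_neq0 q0) K) Kq.
    by field; rewrite !gt_eqF.
  by rewrite ltr_pM2l ?invr_gt0.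
have uE j : \sum_i u i * x i j = net_norm R k / S * \sum_i net_dir R k i * x i j.
  rewrite mulr_sumr; apply: eq_bigr => i _.
  rewrite /u /net_dir; field; rewrite !gt_eqF//.
apply: (@lt_le_trans _ _ (\sum_j (gain (z j) (\sum_i u i * x i j) -
    `|\sum_i e i * x i j|))); last first.
  apply: ler_sum => j _; apply: le_trans (gain_lip _ _ _) _.
  rewrite -big_split/= le_eqVlt; apply/orP; left; apply/eqP; congr gain.
  by apply: eq_bigr => i _; rewrite /e -mulrDl addrC subrK.
rewrite sumrB subr_gt0; apply: lt_le_trans fe _.
under eq_bigr do rewrite uE gainZ ?divr_ge0 ?(ltW norm0) ?(ltW S0)//.
rewrite -mulr_sumr -/G.
have : 1 / 2 <= net_norm R k / S.
  by rewrite ler_pdivlMr//; move: knorm; lra.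
have p0 : 0 <= p%:R :> R by [].
have qp : 0 <= q * p%:R by rewrite mulr_ge0// ltW.
set a := _ / S; move=> a2.
have : 1 / 2 * G <= a * G by rewrite ler_wpM2r//; lra.
lra.
Qed.

End gain_on_net.

(** * Upper bounds on means *)

Section mean_le.
Context d (T : measurableType d) (R : realType) (P : probability T R).

Definition mean_le (Y : T -> R) (b : R) := exists2 m, has_mean P Y m & m <= b.

Lemma mean_leZ (c : R) (Y : T -> R) (b : R) : 0 <= c ->
  mean_le Y b -> mean_le (fun w => c * Y w) (c * b).
Proof.
move=> c0 [m Ym mb]; exists (c * m); first exact: has_meanZ.
exact: ler_wpM2l.
Qed.

Lemma mean_le_sum (I : finType) (Y : I -> T -> R) (b : I -> R) :
  (forall i, mean_le (Y i) (b i)) ->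
  mean_le (fun w => \sum_i Y i w) (\sum_i b i).
Proof.
move=> Yb; have /choice[m Ym] i : exists m, has_mean P (Y i) m /\ m <= b i.
  by have [m ? ?] := Yb i; exists m.
exists (\sum_i m i); first by apply: has_mean_sum => i; case: (Ym i).
by apply: ler_sum => i _; case: (Ym i).
Qed.

Lemma mean_leD (Y1 Y2 : T -> R) (b1 b2 : R) : mean_le Y1 b1 -> mean_le Y2 b2 ->
  mean_le (fun w => Y1 w + Y2 w) (b1 + b2).
Proof.
move=> [m1 Y1m mb1] [m2 Y2m mb2]; exists (m1 + m2); first exact: has_meanD.
exact: lerD.
Qed.

Lemma mean_le0 (b : R) : 0 <= b -> mean_le (fun=> 0) b.
Proof.
move=> b0; exists 0 => //; split; first exact: integrable0.
exact: integral0.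
Qed.

Lemma mean_le_markov (Y : T -> R) (b : R) : mean_le Y b ->
  (forall w, 0 <= Y w) ->
  measurable [set w | Y w < 1] /\ ((1 - b)%:E <= P [set w | Y w < 1]%R)%E.
Proof.
move=> [m Ym mb] Y0; have [mY PY] := has_mean_markov Ym Y0.
by split => //; apply: le_trans PY; rewrite lee_fin lerB.
Qed.

End mean_le.

(** * The event on which every direction has positive gain *)

Section good_event.
Context d (T : measurableType d) (R : realType) (P : probability T R).
Variables (n p : nat) (X : 'I_n -> 'I_p -> {RV P >-> R}) (z : 'I_p -> {RV P >-> R}).
Variable F : set (set T).
Hypothesis indX : mutually_independent (fun ij : 'I_n * 'I_p => X ij.1 ij.2).
Hypothesis lawX : forall i j (A : set R), measurable A ->
  distribution P (X i j) A = normal_prob 0 1 A.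
Hypothesis indz : mutually_independent z.
Hypothesis indXz : independent_classes P <<s var_events z >>
  <<s var_events (fun ij : 'I_n * 'I_p => X ij.1 ij.2) `|` F >>.
Variable q : R.
Hypothesis q01 : 0 < q <= 1.
Hypothesis atom : forall j, q <= fine (P (z j @^-1` [set 0])).

Lemma measurable_weight_set k : measurable (weight_set k : set R).
Proof. by rewrite /weight_set; case: ifP => // _; case: ifP. Qed.

Lemma weight_set_prob (Z : {RV P >-> R}) :
  fine (P (Z @^-1` [set 0])) +
  (fine (P (Z @^-1` [set` `]0, +oo[])) + fine (P (Z @^-1` [set` `]-oo, 0[]))) = 1.
Proof.
have mZ (B : set R) : measurable B -> measurable (Z @^-1` B).
  by move=> mB; rewrite -[_ @^-1` _]setTI; exact: measurable_funP.
apply: EFin_inj; rewrite !EFinD !fineK ?fin_num_measure//; do ?exact: mZ.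
rewrite -measureU; [|exact: mZ|exact: mZ|]; last first.
  apply/seteqP; split => w //= [] /=; rewrite !in_itv/= andbT => z1 z2.
  by have := lt_trans z1 z2; rewrite ltxx.
rewrite -measureU; [|exact: mZ|by apply: measurableU; exact: mZ|]; last first.
  by apply/seteqP; split => w //= [] /= ->; rewrite !in_itv/= ltxx => -[].
rewrite -(@probability_setT _ _ _ P); congr (P _); apply/seteqP; split => w //= _.
by case: (ltgtP (Z w) 0) => Zw; [right; right|right; left|left]; rewrite ?in_itv/= ?Zw.
Qed.

Lemma gain_mgf (v : 'I_n -> R) (l : R) : 0 <= l <= 1 -> \sum_i v i ^+ 2 = 1 ->
  mean_le P (fun w => \prod_j weight l (z j w) (\sum_i v i * X i j w))
    (expR (8 * l ^+ 2 - q * l / 16) ^+ p).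
Proof.
move=> l01 v1; eexists.
  exact: (prod_exp_moment indX lawX indz indXz _ _ measurable_weight_set v1).
rewrite -[X in _ ^+ X]card_ord -prodr_const.
apply: ler_prod => j _.
apply: (weight_mean_le l01 _ _ _ (weight_set_prob (z j))).
- by move=> k; rewrite /weight_set; case: ifP => // _; case: ifP.
- by rewrite atom andbT ltW//; case/andP: q01.
- by rewrite addr_ge0// fine_ge0.
Qed.

(** The n p coefficients have square 1 / n, so the sum has variance p. *)
Lemma sign_mgf (s : {ffun 'I_n -> bool}) (s' : {ffun 'I_p -> bool}) : (0 < n)%N ->
  mean_le P (fun w => expR (\sum_ij (-1) ^+ s ij.1 * (-1) ^+ s' ij.2 /
    Num.sqrt n%:R * X ij.1 ij.2 w)) (expR (p%:R / 2)).
Proof.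
move=> n0; eexists; first exact: (gaussian_mgf indX lawX indz indXz).
rewrite ler_expR le_eqVlt; apply/orP; left; apply/eqP.
under eq_bigr do rewrite !exprMn !sqrr_sign !mul1r exprVn sqr_sqrtr//.
rewrite sumr_const -[LHS]mulr_natr card_prod !card_ord natrM.
by field; rewrite pnatr_eq0 -lt0n.
Qed.

(** A sum of nonnegative terms that is below 1 has all its terms below 1. The two numerical
    hypotheses bound the mean of the net part and of the sign part. *)
Lemma gain_sum_event (delta : R) : (0 < n)%N ->
  (2 * expR 1 * (512 / q + 1)) ^+ n * expR (- (p%:R * q ^+ 2 / 128 / 128)) <= delta / 2 ->
  2 ^+ (n + p) * expR (- (7 / 2 * p%:R)) <= delta / 2 ->
  exists E, [/\ measurable E, ((1 - delta)%:E <= P E)%E & forall w, E w ->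
    forall v : 'I_n -> R, \sum_i v i ^+ 2 != 0 ->
    0 < \sum_j gain (z j w) (\sum_i v i * X i j w)].
Proof.
move=> n0 num1 num2; have /andP[q0 q1] := q01.
(* With this l, the exponent l r + p (8 l^2 - q l / 16) equals - p q^2 / 128^2. *)
pose K := 512 / q; pose l := q / 512; pose r := q * p%:R / 64.
have K0 : 0 < K by apply: divr_gt0 q0; rewrite ltr0n.
have l0 : 0 < l by apply: (divr_gt0 q0); rewrite ltr0n.
have l1 : 0 <= l <= 1 by rewrite /l; apply/andP; split; lra.
pose N := (Num.truncn (K * Num.sqrt n%:R)).+1.
have KN : K * Num.sqrt n%:R < N%:R by exact: truncnS_gt.
(* When the cost is at most K n the first factor is at least 1, so [A k w < 1] forces a gain above
   r. The grid origin has no direction and gets the term 0. *)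
pose A (k : net n N) w := if net_norm R k == 0 then 0 else
  expR (n%:R - net_cost R k / K) * (expR (l * r) *
    \prod_j weight l (z j w) (\sum_i net_dir R k i * X i j w)).
(* [B s w < 1] bounds the signed sum by 4 p sqrt n. Its mean is at most exp(- 7 p / 2), against 2^(n
   + p) sign patterns. *)
pose B (s : {ffun 'I_n -> bool} * {ffun 'I_p -> bool}) w := expR (- (4 * p%:R)) *
  expR (\sum_ij (-1) ^+ s.1 ij.1 * (-1) ^+ s.2 ij.2 / Num.sqrt n%:R *
    X ij.1 ij.2 w).
have weight0 y t : 0 <= weight l y t.
  by apply: le_trans (weight_ge y t (ltW l0)); exact: expR_ge0.
have A0 k w : 0 <= A k w.
  rewrite /A; case: ifP => // _; rewrite mulr_ge0 ?expR_ge0// mulr_ge0 ?expR_ge0//.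
  by rewrite prodr_ge0.
have B0 s w : 0 <= B s w by rewrite mulr_ge0 ?expR_ge0.
have Phi0 w : 0 <= \sum_k A k w + \sum_s B s w by rewrite addr_ge0// sumr_ge0.
have Phi_mean : mean_le P (fun w => \sum_k A k w + \sum_s B s w) delta.
  have [m Ym mb] : mean_le P (fun w => \sum_k A k w + \sum_s B s w)
      (\sum_(k : net n N) expR (n%:R - net_cost R k / K) *
         (expR (l * r) * expR (8 * l ^+ 2 - q * l / 16) ^+ p) +
       \sum_(s : {ffun 'I_n -> bool} * {ffun 'I_p -> bool})
         expR (- (4 * p%:R)) * expR (p%:R / 2)).
    apply: mean_leD; apply: mean_le_sum.
      move=> k; rewrite /A; case: eqVneq => [_|k0].
        by apply: mean_le0; rewrite !mulr_ge0 ?exprn_ge0 ?expR_ge0.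
      apply: mean_leZ; first exact: expR_ge0.
      apply: mean_leZ; first exact: expR_ge0.
      by apply: gain_mgf => //; exact: net_dir_unit.
    by move=> s; apply: mean_leZ; [exact: expR_ge0|exact: sign_mgf].
  exists m => //; apply: (le_trans mb); rewrite [leRHS](splitr delta) lerD//.
    rewrite -mulr_suml; apply: le_trans num1.
    have -> : expR (l * r) * expR (8 * l ^+ 2 - q * l / 16) ^+ p =
        expR (- (p%:R * q ^+ 2 / 128 / 128)).
      by rewrite -expRM_natl -expRD; congr expR; rewrite /l /r; field.
    by rewrite ler_wpM2r ?expR_ge0//; exact: net_weight_sum.
  apply: le_trans num2; rewrite sumr_const card_prod !card_ffun !card_bool !card_ord.
  rewrite le_eqVlt; apply/orP; left; apply/eqP.
  rewrite -[LHS]mulr_natl -expnD natrX -expRD.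
  by congr (_ * expR _); field.
have [mE PE] := mean_le_markov Phi_mean Phi0.
exists [set w | \sum_k A k w + \sum_s B s w < 1]; split => // w /= Phi1.
apply: (@gain_sum_gt0 R n p N (fun i j => X i j w) (fun j => z j w) q) => //.
- move=> k k0 kK.
  have : A k w < 1.
    apply: le_lt_trans Phi1; rewrite (bigD1 k)//= -addrA lerDl addr_ge0//.
      by rewrite sumr_ge0.
    by rewrite sumr_ge0.
  rewrite /A (negPf k0) => A1.
  have {A1} : expR (l * r) *
      \prod_j weight l (z j w) (\sum_i net_dir R k i * X i j w) < 1.
    apply: le_lt_trans A1; rewrite ler_peMl//.
      by rewrite mulr_ge0 ?expR_ge0// prodr_ge0.
    by rewrite -[leLHS]expR0 ler_expR subr_ge0 ler_pdivrMr// mulrC.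
  set G := \sum_j _ => A1.
  have : expR (l * r) * expR (- (l * G)) < 1.
    apply: le_lt_trans A1; rewrite ler_wpM2l ?expR_ge0//.
    rewrite /G mulr_sumr -sumrN expR_sum; apply: ler_prod => j _.
    by rewrite expR_ge0 weight_ge// ltW.
  by rewrite -expRD -mulrBr -[ltRHS]expR0 ltr_expR pmulr_rlt0// subr_lt0.
- move=> s s'; have : B (s, s') w < 1.
    apply: le_lt_trans Phi1; rewrite [X in _ + X](bigD1 (s, s'))//= addrCA lerDl.
    by rewrite addr_ge0// sumr_ge0.
  rewrite /B/= -expRD -[ltRHS]expR0 ltr_expR addrC subr_lt0 => Bw.
  rewrite -ltr_pdivrMr ?sqrtr_gt0 ?ltr0n// mulr_suml.
  by under eq_bigr do rewrite mulrAC.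
Qed.

End good_event.

(** * Numerical consequences of the smallness assumption *)

Lemma expRN_inv_le (R : realType) (delta : R) : 0 < delta ->
  expR (- (2 / delta)) <= delta / 2.
Proof.
move=> d0; rewrite expRN -[leRHS]invrK invf_div lef_pV2 ?posrE ?expR_gt0 ?divr_gt0//.
by apply: le_trans (expR_ge1Dx _); lra.
Qed.

(** Squaring the assumption gives n L^2 <= c^2 p q^2 with L = log(e p / n) >= 1. So p q^2 dominates
    n L, while exp(L) dominates the base of the net count. *)
Lemma sample_size_bounds (R : realType) (delta q : R) (n p : nat) :
  0 < delta < 1 -> (0 < n <= p)%N -> 0 < q <= 1 ->
  Num.sqrt (n%:R / p%:R) * ln (expR 1 * p%:R / n%:R) / q <= delta / 100 / 100 ->
  (2 * expR 1 * (512 / q + 1)) ^+ n * expR (- (p%:R * q ^+ 2 / 128 / 128)) <= delta / 2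
  /\ 2 ^+ (n + p) * expR (- (7 / 2 * p%:R)) <= delta / 2.
Proof.
move=> /andP[d0 d1] /andP[n0 np] /andP[q0 q1].
pose c := delta / 100 / 100.
have c_gt0 : 0 < c by rewrite !divr_gt0 ?ltr0n.
(* The three bounds on c serve, in turn, to fit the base of the net count below exp(L), to force p
   >= 2 / delta, and to make p q^2 / 128^2 exceed n L by 2 / delta. *)
have c1 : c * (8 * 513) <= 1 by rewrite /c; lra.
have c_delta : c ^+ 2 <= delta / 2 by rewrite /c; nra.
have c128 : c ^+ 2 * (1 + 2 / delta) <= (128 * 128)^-1.
  have -> : c ^+ 2 * (1 + 2 / delta) = delta * (delta + 2) * (100 * 100 * 100 * 100)^-1.
    by rewrite /c; field; rewrite gt_eqF.
  nra.
rewrite -/c; move: c c_gt0 c1 c_delta c128 => c c0 c1 c_delta c128.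
set s := Num.sqrt _; set L := ln _ => sL.
have p0 : (0 < p)%N := leq_trans n0 np.
have n0R : 0 < n%:R :> R by rewrite ltr0n.
have p0R : 0 < p%:R :> R by rewrite ltr0n.
have n1R : 1 <= n%:R :> R by rewrite ler1n.
have npR : n%:R <= p%:R :> R by rewrite ler_nat.
have s0 : 0 < s by rewrite sqrtr_gt0 divr_gt0.
have s2 : s ^+ 2 * p%:R = n%:R.
  by rewrite sqr_sqrtr ?divr_ge0// mulfVK ?gt_eqF.
have e0 := expR_gt0 (1 : R).
have a0 : 0 < expR 1 * p%:R / n%:R :> R by rewrite divr_gt0 ?mulr_gt0.
have eL : expR L = expR 1 * p%:R / n%:R by rewrite lnK.
have L1 : 1 <= L.
  by rewrite -ler_expR eL -mulrA ler_peMr ?(ltW e0)// ler_pdivlMr// mul1r.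
have {}sL : s * L <= c * q by rewrite -ler_pdivrMr.
have sq : s <= c * q by apply: le_trans sL; rewrite ler_peMr// ltW.
have sL0 : 0 <= s * L by rewrite mulr_ge0 ?(ltW s0)//; lra.
have nL : n%:R * L ^+ 2 <= c ^+ 2 * (p%:R * q ^+ 2).
  have : (s * L) ^+ 2 <= (c * q) ^+ 2.
    by rewrite ler_sqr// nnegrE mulr_ge0// ltW.
  by move=> /(ler_wpM2l (ltW p0R)); rewrite !exprMn -s2; lra.
have nL1 : n%:R * L <= c ^+ 2 * (p%:R * q ^+ 2).
  apply: le_trans nL; rewrite ler_wpM2l ?(ltW n0R)// expr2 ler_peMl//; lra.
have e4 : expR 1 <= 4 :> R.
  have := expR_half_bounds R; move=> /andP[_ h].
  have -> : 1 = 2 * (1 / 2) :> R by field.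
  rewrite (expRM_natl 2); have := expR_ge0 (1 / 2 : R); nra.
have e2 : 2 <= expR 1 :> R by apply: le_trans (expR_ge1Dx _); lra.
pose D := p%:R * q ^+ 2.
have c2 : 0 < c ^+ 2 by rewrite exprn_gt0.
have nLD : n%:R * L * (1 + 2 / delta) <= D / 128 / 128.
  have : n%:R * L * (1 + 2 / delta) <= c ^+ 2 * D * (1 + 2 / delta).
    by rewrite ler_wpM2r// addr_ge0// divr_ge0// ltW.
  move=> /le_trans; apply.
  have D0 : 0 <= D by rewrite mulr_ge0 ?sqr_ge0.
  have -> : c ^+ 2 * D * (1 + 2 / delta) = (c ^+ 2 * (1 + 2 / delta)) * D by ring.
  by apply: le_trans (ler_wpM2r D0 c128) _; rewrite invfM mulrC mulrA.
have q1' : 1 <= q^-1 by rewrite invf_ge1.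
split.
- have w0 : 0 <= 512 / q + 1 by lra.
  (* Since s <= 1 and s <= c q, n = s^2 p <= c q p; hence the left side, at most 8 * 513 / q, is at
     most p / n. *)
  have qpn : 2 * expR 1 * (512 / q + 1) <= expR L.
    have snp : n%:R <= s * p%:R.
      have s1 : s <= 1 by rewrite -(@expr_le1 _ 2) ?(ltW s0)//; nra.
      by rewrite -s2 expr2 -mulrA ler_piMl ?mulr_ge0 ?(ltW s0).
    have cq : q^-1 * n%:R <= c * p%:R.
      rewrite mulrC ler_pdivrMr// mulrAC; apply: le_trans snp _.
      by rewrite ler_wpM2r// ltW.
    have qn : 512 / q + 1 <= 513 * q^-1 by lra.
    have npc : 8 * (513 * q^-1) * n%:R <= p%:R.
      apply: (@le_trans _ _ (c * (8 * 513) * p%:R)); first by lra.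
      by rewrite ler_piMl.
    rewrite eL ler_pdivlMr//.
    apply: (@le_trans _ _ p%:R); last by rewrite ler_peMl//; lra.
    apply: le_trans (ler_wpM2r (ltW n0R) _) npc.
    by have := ler_wpM2r w0 e4; lra.
  apply: (@le_trans _ _ (expR (- (2 / delta)))).
    apply: (@le_trans _ _ (expR L ^+ n * expR (- (D / 128 / 128)))).
      apply: (ler_wpM2r (expR_ge0 _)); apply: lerXn2r qpn; rewrite nnegrE; last exact: expR_ge0.
      by apply: mulr_ge0 w0; lra.
    rewrite -expRM_natl -expRD ler_expR.
    have : 2 / delta <= n%:R * L * (2 / delta).
      by rewrite ler_peMl ?divr_ge0 ?(ltW d0)// mulr_ege1.
    move: nLD; rewrite mulrDr mulr1; lra.
  exact: expRN_inv_le.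
- apply: (@le_trans _ _ (expR (- (2 / delta)))); last exact: expRN_inv_le.
  apply: (@le_trans _ _ (expR 1 ^+ (n + p) * expR (- (7 / 2 * p%:R)))).
    by rewrite ler_wpM2r ?expR_ge0// lerXn2r ?nnegrE ?(ltW e0).
  rewrite -expRM_natl mulr1 -expRD ler_expR natrD.
  (* As n <= p, the exponent n + p - 7 p / 2 is at most - 3 p / 2. *)
  have : 2 / delta <= p%:R; last by lra.
  have pc : 1 <= c ^+ 2 * p%:R.
    apply: (@le_trans _ _ (c ^+ 2 * D)).
      by apply: le_trans nL1; rewrite mulr_ege1.
    by rewrite ler_wpM2l ?(ltW c2)// ler_piMr// expr_le1// ltW.
  rewrite ler_pdivrMr//.
  by have := ler_wpM2r (ltW p0R) c_delta; lra.
Qed.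

(** * From positive gain to exact recovery *)

Lemma l1norm_argmin_eq0 (R : realType) n p (A : 'M[R]_(n, p)) (z : 'cV[R]_p)
    (v : 'cV[R]_n) :
  (\sum_i v i 0 ^+ 2 != 0 -> 0 < \sum_j gain (z j 0) (\sum_i v i 0 * A i j)) ->
  l1norm (z - A^T *m v) <= l1norm z -> v = 0.
Proof.
move=> gain_gt0 lev; apply/colP => i; rewrite mxE.
have [/eqP v0|/gain_gt0] := eqVneq (\sum_i v i 0 ^+ 2) 0.
  move: v0; rewrite psumr_eq0 => [|? _]; last exact: sqr_ge0.
  by move=> /allP/(_ i); rewrite mem_index_enum => /(_ isT); rewrite sqrf_eq0 => /eqP.
(* Summed over coordinates, [norm_ge_gain] would make the norm of z - A^T v exceed that of z. *)
rewrite ltNge => /negP[]; rewrite -(lerD2l (l1norm z)) addr0.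
apply: le_trans lev; rewrite /l1norm -big_split/=; apply: ler_sum => j _.
apply: le_trans (norm_ge_gain _ _) _; rewrite !mxE.
by under [in leRHS]eq_bigr do rewrite mxE mulrC.
Qed.

(** Removing from [E] a measurable null set that covers the failures of [Q] leaves its probability
    unchanged. *)
Lemma with_prob_ge_ae d (T : measurableType d) (R : realType)
    (P : probability T R) (q : R) (E : set T) (Q : T -> Prop) (A : set T) :
  measurable E -> (q%:E <= P E)%E -> {ae P, forall w, Q w} ->
  (forall w, E w -> Q w -> A w) -> with_prob_ge P q A.
Proof.
move=> mE PE [N [mN N0 QN]] EQA; exists (E `\` N); split.
- exact: measurableD.
- move=> w [Ew Nw]; apply: EQA => //; apply: contrapT => Qw; apply: Nw.
  exact: QN.
- apply: le_trans PE _.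
  apply: (@le_trans _ _ (P ((E `\` N) `|` N))).
    apply: le_measure; rewrite ?inE//; first by apply: measurableU => //; exact: measurableD.
    by move=> w Ew; have [Nw|Nw] := pselect (N w); [right|left].
  apply: le_trans (measureU2 _ _ _) _ => //; first exact: measurableD.
  by rewrite [X in (_ + X)%E](_ : _ = 0%E) ?adde0.
Qed.

Theorem corollary4p1 (R : realType) (delta : R) (hdelta : 0 < delta < 1) :
  exists2 c : R, 0 < c &
  forall (n p : nat) (d : measure_display) (T : measurableType d)
    (P : probability T R)
    (X : 'I_n -> 'I_p -> {RV P >-> R})
    (thetahat z : 'I_p -> {RV P >-> R})
    (epsilon : R) (Q : 'I_p -> probability R R)
    (util : T -> 'cV[R]_n),
  let Xm := random_mx X in
  let theta := random_col thetahat in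
  let eta := fun w => theta w + random_col z w in
  let thetatil := fun w => (Xm w)^T *m util w in
  (0 < n <= p)%N ->
  mutually_independent (fun ij : 'I_n * 'I_p => X ij.1 ij.2) ->
  (forall i j (A : set R), measurable A ->
     distribution P (X i j) A = normal_prob 0 1 A) ->
  {ae P, forall w, ((theta w)^T <= Xm w)%MS} ->
  independent_classes P
    <<s var_events z >>
    <<s var_events (fun ij : 'I_n * 'I_p => X ij.1 ij.2)
        `|` var_events thetahat >> ->
  0 <= epsilon < 1 ->
  mutually_independent z ->
  (forall j (A : set R), measurable A ->
     (distribution P (z j) A =
      (1 - epsilon)%:E * \d_(0%R : R) A + epsilon%:E * Q j A)%E) ->
  {ae P, forall w,
     argmin (fun u : 'cV[R]_n => l1norm (eta w - (Xm w)^T *m u)) (util w)} ->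
  Num.sqrt (n%:R / p%:R) * ln (expR 1 * p%:R / n%:R) / (1 - epsilon) <= c ->
  with_prob_ge P (1 - delta) [set w | thetatil w = theta w].
Proof.
exists (delta / 100 / 100).
  by rewrite !divr_gt0 ?ltr0n//; case/andP: hdelta.
move=> n p d T P X thetahat z epsilon Q util Xm theta eta thetatil np indX lawX.
move=> rowX indXz eps01 indz lawz umin hc.
pose q := 1 - epsilon.
have q01 : 0 < q <= 1 by rewrite /q; lra.
have [num1 num2] := sample_size_bounds hdelta np q01 hc.
(* Only an inequality, because Q_j may itself charge 0. *)
have atom j : q <= fine (P (z j @^-1` [set 0])).
  have mz0 : measurable (z j @^-1` [set 0]).
    by rewrite -[_ @^-1` _]setTI; exact: measurable_funP.
  rewrite -lee_fin fineK ?fin_num_measure//.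
  have := lawz j [set 0] (measurable_set1 _).
  rewrite /distribution/= /pushforward => ->.
  rewrite diracE mem_set// mule1 leeDl// mule_ge0// lee_fin.
  by case/andP: eps01.
have [n0 _] := andP np.
have [E [mE PE posE]] := gain_sum_event indX lawX indz indXz q01 atom n0 num1 num2.
apply: (with_prob_ge_ae mE PE (filterI rowX umin)) => w Ew [/submxP[D thetaD] uw].
pose u := D^T.
have thetaE : theta w = (Xm w)^T *m u.
  by rewrite -[LHS]trmxK thetaD trmx_mul.
(* The minimiser is compared with [u], whose residual is exactly z. *)
have := uw u; rewrite /eta thetaE [_ *m u + _]addrC addrK => uminw.
have : util w - u = 0.
  apply: (@l1norm_argmin_eq0 _ _ _ (Xm w) (random_col z w)).
    move=> v0; have := posE w Ew (fun i => (util w - u) i 0) v0.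
    congr (0 < _); apply: eq_bigr => j _; rewrite mxE; congr gain.
    by apply: eq_bigr => i _; rewrite [Xm w i j]mxE.
  apply: le_trans uminw.
  by rewrite mulmxBr opprB addrA.
by move=> /subr0_eq uE; rewrite /thetatil /= uE thetaE.
Qed.
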